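(* Let $A\in\mathbb{C}^{n\times n}$ be Hermitian positive definite with smallest and largest eigenvalues $\lambda_{\min}$ and $\lambda_{\max}$ and condition number $\kappa=\lambda_{\max}/\lambda_{\min}$, let $\alpha\in(0,1)$, and let $d(i,j)$ denote the geodesic distance of the nodes $i$ and $j$ in the graph of $A$. Then for all $i,j\in\{1,\dots,n\}$ with $d(i,j)\ge 2$, $$|[A^\alpha]_{ij}|\le 2\,\lambda_{\min}^{\alpha-1}\,\|A\|_\infty\, q^{\,d(i,j)-1}\qquad\text{with}\qquad q=\frac{\sqrt\kappa-1}{\sqrt\kappa+1}.$$
   Context: For Hermitian positive definite $A=V\operatorname{diag}(\lambda_1,\dots,\lambda_n)V^H$ with $V$ unitary, $A^\alpha=V\operatorname{diag}(\lambda_1^\alpha,\dots,\lambda_n^\alpha)V^H$. $\|A\|_\infty=\max_i\sum_{k}|a_{ik}|$ is the maximum absolute row sum. The graph of $A=(a_{ij})$ has nodes $1,\dots,n$ and edges $\{(i,j): a_{ij}\ne 0,\ i\ne j\}$. The geodesic distance $d(i,j)$ is the length of a shortest path from $i$ to $j$ in this graph, with $d(i,j)=\infty$ if no path exists; in that case $q^{d(i,j)-1}$ is read as $0$ (note $0\le q<1$). *)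

(* Defs.v *)
From HB Require Import structures.
From mathcomp Require Import all_boot all_order all_algebra.
From mathcomp Require Import complex.
From mathcomp Require Import reals exp.

Set Implicit Arguments.
Unset Strict Implicit.
Unset Printing Implicit Defensive.

Import Order.TTheory GRing.Theory Num.Theory.
Export ComplexField.Normc.

Local Open Scope ring_scope.
Local Open Scope complex_scope.
Local Open Scope sesquilinear_scope.

Section Distance.
Variables (T : finType) (e : rel T).

Definition walk (k : nat) (x y : T) : bool :=
  [exists p : k.-tuple T, path e x p && (last x p == y)].

Lemma walkP k x y :
  reflect (exists p : seq T, [/\ size p = k, path e x p & last x p = y])
          (walk k x y).
Proof.
apply: (iffP existsP) => [[p /andP[ep /eqP lp]]|[p [sp ep lp]]].
  by exists p; rewrite size_tuple.
by subst k; exists (in_tuple p); rewrite /= ep lp eqxx.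
Qed.

Lemma connect_walk x y : connect e x y -> exists k, walk k x y.
Proof.
by case/connectP=> p ep ->; exists (size p); apply/walkP; exists p.
Qed.

(* [None] stands for an infinite distance. *)
Definition gdist (x y : T) : option nat :=
  if @idP (connect e x y) is ReflectT xy then Some (ex_minn (connect_walk xy))
  else None.

Lemma gdist_SomeP x y k :
  gdist x y = Some k <-> walk k x y /\ forall m, walk m x y -> (k <= m)%N.
Proof.
rewrite /gdist; case: {-}_ / idP => [xy|nxy].
  case: ex_minnP => m wm min_m; split=> [[<-]//|[wk min_k]].
  by congr Some; apply/eqP; rewrite eqn_leq min_m ?min_k.
split=> // -[/walkP[p [_ ep lp]] _]; case: nxy.
by apply/connectP; exists p.
Qed.

Lemma gdist_NoneP x y : gdist x y = None <-> forall k, ~~ walk k x y.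
Proof.
rewrite /gdist; case: {-}_ / idP => [xy|nxy]; split=> //.
  by have [k wk] := connect_walk xy => /(_ k); rewrite wk.
move=> _ k; apply/negP => /walkP[p [_ ep lp]]; case: nxy.
by apply/connectP; exists p.
Qed.

End Distance.

Definition dist_ge (d : option nat) (m : nat) : bool :=
  if d is Some k then (m <= k)%N else true.

(* q ^ (d - 1), read as 0 when d is infinite *)
Definition decay (R : pzRingType) (q : R) (d : option nat) : R :=
  if d is Some k then q ^+ (k - 1) else 0.

Definition mxgraph (R : nmodType) (n : nat) (A : 'M[R]_n) : rel 'I_n :=
  fun i j => (A i j != 0) && (i != j).

Lemma unitary_diag_map (C : numClosedFieldType) (m : nat) (V W : 'M[C]_m)
    (d d' : 'rV[C]_m) (f : C -> C) :
  V \is unitarymx -> W \is unitarymx ->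
  V *m diag_mx d *m V^t* = W *m diag_mx d' *m W^t* ->
  V *m diag_mx (map_mx f d) *m V^t* = W *m diag_mx (map_mx f d') *m W^t*.
Proof.
move=> uV uW eVW.
have VV : V^t* *m V = 1%:M by apply/mulmx1C/unitarymxP.
have WW : W^t* *m W = 1%:M by apply/mulmx1C/unitarymxP.
have comm : W^t* *m V *m diag_mx d = diag_mx d' *m (W^t* *m V).
  have /(congr1 (fun X => W^t* *m X *m V)) := eVW.
  by rewrite !mulmxA WW mul1mx -!mulmxA VV mulmx1.
have commf : W^t* *m V *m diag_mx (map_mx f d)
           = diag_mx (map_mx f d') *m (W^t* *m V).
  apply/matrixP => i j; move/matrixP/(_ i j): comm.
  rewrite mul_mx_diag mul_diag_mx mul_mx_diag mul_diag_mx !mxE.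
  set z := \sum_k _ => eqz.
  have [-> | z0] := eqVneq z 0; first by rewrite mul0r mulr0.
  by rewrite mulrC; congr (f _ * _); apply: (mulIf z0); rewrite -eqz mulrC.
have /(congr1 (fun X => W *m X *m V^t*)) := commf.
rewrite !mulmxA (unitarymxP uW) mul1mx => ->.
by rewrite -mulmxA (unitarymxP uV) mulmx1.
Qed.

Section HermitianMatrices.
Variables (R : realType) (n : nat).
Implicit Types (A V : 'M[R[i]]_n) (l : R).

Definition hpdmx A : Prop :=
  A \is hermsymmx /\
  forall x : 'cV[R[i]]_n, x != 0 -> 0 < (x^t* *m A *m x) 0 0.

(* The order of R[i] is partial: l%:C <= mu forces mu to be real. *)
Definition smallest_eigenvalue A l : Prop :=
  eigenvalue A l%:C /\ forall mu : R[i], eigenvalue A mu -> l%:C <= mu.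

Definition largest_eigenvalue A l : Prop :=
  eigenvalue A l%:C /\ forall mu : R[i], eigenvalue A mu -> mu <= l%:C.

Definition rowsum_norm A : R := \big[Num.max/0]_i \sum_k normc (A i k).

(* The library diagonalizes A as P^-1 *m diag_mx D *m P with P unitary, so that
   V is P^t*; [hermpowE] shows that any other unitary diagonalization yields the
   same power. *)
Definition hermpow A (alpha : R) : 'M[R[i]]_n :=
  (spectralmx A)^t*
    *m diag_mx (map_mx (fun z => (complex.Re z `^ alpha)%:C) (spectral_diag A))
    *m spectralmx A.

Lemma hermpowE A V (lam : 'rV[R]_n) (alpha : R) :
  V \is unitarymx ->
  A = V *m diag_mx (map_mx (fun l => l%:C) lam) *m V^t* ->
  hermpow A alpha = V *m diag_mx (map_mx (fun l => (l `^ alpha)%:C) lam) *m V^t*.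
Proof.
move=> uV defA.
have uP := spectral_unitarymx A.
have normA : A \is normalmx.
  apply: hermitian_normalmx; apply/is_hermitianmxP.
  rewrite expr0 scale1r defA !trmx_mul !map_mxM map_trmx trmxK -map_mx_comp.
  rewrite tr_diag_mx map_diag_mx (map_mx_id (@conjCK _)) mulmxA.
  congr (_ *m diag_mx _ *m _); apply/matrixP => i j; rewrite !mxE.
  exact/esym/conjc_real.
have uQ : (spectralmx A)^t* \is unitarymx by rewrite trmxC_unitary.
have /orthomx_spectralP := normA; rewrite invmx_unitary // {1}defA => eA.
have := unitary_diag_map (fun z => (complex.Re z `^ alpha)%:C) uV uQ.
rewrite trmxCK => /(_ _ _ eA) fE.
rewrite /hermpow -fE -map_mx_comp.
by congr (_ *m diag_mx _ *m _); apply/matrixP => i j; rewrite !mxE.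
Qed.

End HermitianMatrices.

(* Main.v *)
(** Since A^alpha = A A^(alpha-1), it suffices to bound the entries (k, j) of
    A^(alpha-1), which are sums of c_l x_l^(alpha-1) over the eigenvalues x_l with
    weights c_l of total mass at most 1; these weights annihilate the powers x^e
    with e < d(k,j).  For the resolvents
    1/(x+t) the residual is a Chebyshev polynomial of [lmin, lmax] normalized to
    1 at -t, which gives the bound 2 q^d(k,j) / (lmin+t).  The passage to
    x^(alpha-1) usually writes it as an integral of resolvents; here the integral
    is replaced by phi(x) = sum_{k in Z} p^k / (x + r^k) with p = r^alpha, which
    satisfies phi(r x) = r^(alpha-1) phi(x) exactly and decreases, so that
    phi(x)/phi(lmin) tends to (x/lmin)^(alpha-1) uniformly as r tends to 1. *)

Require Import Defs.
From mathcomp Require Import all_boot all_order all_algebra.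
From mathcomp Require Import complex.
From mathcomp Require Import reals exp.
From mathcomp Require Import boolp classical_sets topology normedtype sequences.
From mathcomp Require Import ring lra.

Import Order.TTheory GRing.Theory Num.Theory.
Import numFieldNormedType.Exports.
Local Open Scope ring_scope.

(** * A two-sided series of resolvents with an exact scaling law *)

Section ScalingSeries.
Local Open Scope classical_set_scope.
Context {R : realType}.
Variables p r : R.
Hypotheses (p_gt1 : 1 < p) (ltpr : p < r).

(* The terms of phi with k >= 0 and, with index k.+1, those with k < 0. *)
Let u (x : R) : R^nat := fun k => p ^+ k / (x + r ^+ k).
Let v (x : R) : R^nat := fun k => (p ^+ k.+1)^-1 / (x + (r ^+ k.+1)^-1).

Let p_gt0 : 0 < p. Proof. exact: lt_trans p_gt1. Qed.
Let r_gt0 : 0 < r. Proof. exact: lt_trans ltpr. Qed.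
Let rX_gt0 k : 0 < r ^+ k. Proof. exact: exprn_gt0. Qed.
Let pX_gt0 k : 0 < p ^+ k. Proof. exact: exprn_gt0. Qed.

Let u_gt0 x k : 0 < x -> 0 < u x k.
Proof. by move=> x0; rewrite divr_gt0 ?addr_gt0. Qed.

Let v_gt0 x k : 0 < x -> 0 < v x k.
Proof. by move=> x0; rewrite divr_gt0 ?addr_gt0 ?invr_gt0. Qed.

Let cvg_u x : 0 < x -> cvgn (series (u x)).
Proof.
(* Dropping [x] from the denominator leaves the ratio [p / r], below 1 since [p < r]; in [cvg_v]
   dropping the power of [r] instead leaves the ratio [p^-1], below 1 since [1 < p]. *)
move=> x0; apply: (series_le_cvg (v_ := geometric 1 (p / r))) => [k|k|k|].
- exact/ltW/u_gt0.
- by rewrite /= mul1r exprn_ge0 // divr_ge0 ?ltW.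
- rewrite /= mul1r expr_div_n ler_pM2l ?pX_gt0 // lef_pV2 ?posrE ?addr_gt0 //.
  by rewrite lerDr ltW.
- apply: is_cvg_geometric_series; rewrite ger0_norm ?divr_ge0 ?ltW //.
  by rewrite ltr_pdivrMr // mul1r.
Qed.

Let cvg_v x : 0 < x -> cvgn (series (v x)).
Proof.
move=> x0; apply: (series_le_cvg (v_ := geometric (p^-1 / x) p^-1)) => [k|k|k|].
- exact/ltW/v_gt0.
- by rewrite /= mulr_ge0 ?exprn_ge0 ?divr_ge0 ?invr_ge0 ?ltW.
- rewrite /= mulrAC -exprS exprVn ler_pM2l ?invr_gt0 ?pX_gt0 //.
  by rewrite lef_pV2 ?posrE ?addr_gt0 ?invr_gt0 // lerDl invr_ge0 ltW.
- apply: is_cvg_geometric_series; rewrite ger0_norm ?invr_ge0 ?ltW //.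
  by rewrite invf_lt1.
Qed.

Let phi x := limn (series (u x)) + limn (series (v x)).

Let cvg_phi x : 0 < x -> (series (u x) n + series (v x) n) @[n --> \oo] --> phi x.
Proof. by move=> x0; apply: cvgD; [exact: cvg_u | exact: cvg_v]. Qed.

(** Replacing [x] by [r * x] shifts the two-sided index by one and produces the factor [p / r]. The
    single term that crosses from [v] to [u] is [v x 0], which explains its gain in [US] and its
    loss in [VS]. *)
Let phi_scale x : 0 < x -> phi (r * x) = p / r * phi x.
Proof.
move=> x0; have rx0 : 0 < r * x by rewrite mulr_gt0.
have uS k : u (r * x) k.+1 = p / r * u x k.
  have := rX_gt0 k; have := r_gt0; rewrite /u !exprS => ? ?.
  by field; rewrite ?gt_eqF //= ?addr_gt0 // ?mulr_gt0.
have u0 : u (r * x) 0 = p / r * v x 0.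
  rewrite /u /v !expr0 !expr1; have := r_gt0; have := p_gt0 => ? ?.
  by field; rewrite ?gt_eqF //= ?addr_gt0 // ?mulr_gt0.
have vS k : v (r * x) k = p / r * v x k.+1.
  have := rX_gt0 k; have := pX_gt0 k; have := r_gt0; have := p_gt0.
  rewrite /v !exprS => ? ? ? ?.
  by field; rewrite ?gt_eqF //= ?addr_gt0 // ?mulr_gt0 ?addr_gt0 // ?mulr_gt0.
have US : limn (series (u (r * x))) = p / r * (v x 0 + limn (series (u x))).
  apply: cvg_lim => //; rewrite -cvg_shiftS.
  have -> : [sequence (series (u (r * x))) n.+1]_n
          = (fun n => p / r * (v x 0 + series (u x) n)).
    apply/funext => n /=; rewrite /series /= big_nat_recl // u0 mulrDr mulr_sumr.
    by congr (_ + _); apply: eq_bigr => k _; rewrite uS.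
  by apply: cvgMl_tmp; apply: cvgD; [exact: cvg_cst | exact: cvg_u].
have VS : limn (series (v (r * x))) = p / r * (limn (series (v x)) - v x 0).
  apply: cvg_lim => //.
  have -> : series (v (r * x))
          = (fun n => p / r * ([sequence (series (v x)) n.+1]_n n - v x 0)).
    apply/funext => n; rewrite /series /= big_nat_recl // addrC addKr mulr_sumr.
    by apply: eq_bigr => k _; rewrite vS.
  apply: cvgMl_tmp; apply: cvgB; last exact: cvg_cst.
  by rewrite cvg_shiftS; exact: cvg_v.
by rewrite /phi US VS -mulrDr; congr (_ * _); ring.
Qed.

(** Every partial sum of [phi] is a combination of resolvents [1 / (x + t)], [t > 0], with positive
    coefficients. Hence an inequality that holds for all resolvents with the same constant [C] holds
    for the partial sums, and then for their limit. *)
Lemma scaling_resolvent_series : exists phi : R -> R,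
  [/\ forall x, 0 < x -> 0 < phi x,
      forall x y, 0 < x -> x <= y -> phi y <= phi x,
      forall x, 0 < x -> phi (r * x) = p / r * phi x
    & forall (I : finType) (c x : I -> R) (a C : R),
        0 < a -> (forall i, 0 < x i) ->
        (forall t, 0 < t -> \sum_i c i / (x i + t) <= C / (a + t)) ->
        \sum_i c i * phi (x i) <= C * phi a].
Proof.
exists phi; split=> [x x0|x y x0 xy|//|I c x a C a0 x0 resolvent_le].
- apply: (@lt_le_trans _ _ (u x 0)); first exact: u_gt0.
  apply: (cvgr_to_ge (cvg_phi _ x0)); exists 1%N => // n /= n0.
  rewrite -(prednK n0) /series /= big_nat_recl // -addrA lerDl addr_ge0 //.
    by apply: sumr_ge0 => k _; exact/ltW/u_gt0.
  by apply: sumr_ge0 => k _; exact/ltW/v_gt0.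
- have y0 := lt_le_trans x0 xy.
  apply: (ler_cvg_to (cvg_phi _ y0) (cvg_phi _ x0)); apply: nearW => n.
  apply: lerD; apply: ler_sum => k _; rewrite ler_pM2l ?invr_gt0 ?pX_gt0 //.
    by rewrite lef_pV2 ?posrE ?addr_gt0 // lerD2r.
  by rewrite lef_pV2 ?posrE ?addr_gt0 ?invr_gt0 // lerD2r.
- have lim_lhs : (\sum_i c i * (series (u (x i)) n + series (v (x i)) n))
                   @[n --> \oo] --> \sum_i c i * phi (x i).
    apply: cvg_big => [|i _]; first exact: add_continuous.
     apply: cvgMl_tmp; exact: cvg_phi.
  have lim_rhs : (C * (series (u a) n + series (v a) n))
                   @[n --> \oo] --> C * phi a by apply: cvgMl_tmp; exact: cvg_phi.
  apply: (ler_cvg_to lim_lhs lim_rhs); apply: nearW => n.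
  rewrite /series /=.
  under eq_bigr do rewrite mulrDr !mulr_sumr.
  rewrite big_split mulrDr !mulr_sumr /= ![\sum_i \sum_(0 <= _ < _) _]exchange_big.
  apply: lerD; apply: ler_sum => k _ /=.
    under eq_bigr do rewrite mulrCA.
    by rewrite -mulr_sumr mulrCA ler_pM2l ?pX_gt0 // resolvent_le.
  under eq_bigr do rewrite mulrCA.
  by rewrite -mulr_sumr mulrCA ler_pM2l ?invr_gt0 ?pX_gt0 // resolvent_le ?invr_gt0.
Qed.

End ScalingSeries.

(** * From resolvents to the power [alpha - 1] *)

Lemma exprn_bracket {R : realType} (s z : R) : 1 < s -> 1 <= z ->
  exists k, s ^+ k <= z < s ^+ k.+1.
Proof.
move=> s1 z1; have s0 : 0 < s by exact: lt_trans s1.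
have z0 : 0 < z by exact: lt_le_trans z1.
have lns : 0 < ln s by rewrite ln_gt0.
have lnz : 0 <= ln z by rewrite ln_ge0.
have /andP[] := truncn_itv (divr_ge0 lnz (ltW lns)).
set k := Num.truncn _; rewrite ler_pdivlMr // ltr_pdivrMr // => kz zk.
exists k; rewrite -ler_ln ?posrE ?exprn_gt0 // -ltr_ln ?posrE ?exprn_gt0 //.
by rewrite !lnXn // -!(mulr_natl (ln s)) kz.
Qed.

(** On the grid of points [r ^+ k * a] the quotient [phi x / phi a] coincides with
    [(x / a) ^ (alpha - 1)]. Both are nonincreasing in [x], so between grid points they differ by at
    most one grid step of values, which tends to 0 with the mesh. *)
Lemma powR_le_resolvents {R : realType} (I : finType) (c x : I -> R)
    (a C alpha : R) :
  0 < alpha < 1 -> 0 < a -> (forall i, a <= x i) ->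
  (forall t, 0 < t -> \sum_i c i / (x i + t) <= C / (a + t)) ->
  \sum_i c i * x i `^ (alpha - 1) <= C * a `^ (alpha - 1).
Proof.
move=> /andP[al0 al1] a0 ax resolvent_le.
have x0 i : 0 < x i by exact: lt_le_trans (ax i).
have powR1r b : 1 `^ b = 1 :> R by rewrite powR1.
have be0 : 0 < 1 - alpha by rewrite subr_gt0.
pose z i := (x i / a) `^ (1 - alpha).
have z1 i : 1 <= z i.
  rewrite -[leLHS](powR1r (1 - alpha)).
  have xa1 : 1 <= x i / a by rewrite ler_pdivlMr ?mul1r.
  by apply: ge0_ler_powR; rewrite ?nnegrE ?(le_trans ler01 xa1) // ltW.
have zE i : (z i)^-1 * a `^ (alpha - 1) = x i `^ (alpha - 1).
  rewrite -powRN opprB -powRM ?divfK ?gt_eqF //; last exact: ltW.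
  by rewrite divr_ge0 ?ltW.
suff sum_le : \sum_i c i / z i <= C.
  under eq_bigr do rewrite -zE mulrA.
  by rewrite -mulr_suml ler_pM2r ?powR_gt0.
suff approx s : 1 < s -> \sum_i c i / z i <= C + (s - 1) * \sum_i `|c i|.
  (* The choice [s = 1 + e / (K + 1)] makes the error at most [e]; the added 1 covers [K = 0]. *)
  apply/ler_addgt0Pr => e e0; set K := \sum_i `|c i| in approx.
  have K0 : 0 <= K by apply: sumr_ge0.
  have K1 : 0 < K + 1 by rewrite ltr_wpDl.
  apply: le_trans (approx (1 + e / (K + 1)) _) _.
    by rewrite ltrDl divr_gt0.
  rewrite lerD2l addrC addKr -mulrA ler_piMr ?ltW //.
  by rewrite mulrC ltr_pdivrMr // mul1r ltrDl.
move=> s1; have s0 : 0 < s by exact: lt_trans s1.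
(* Chosen so that [s = r ^ (1 - alpha)] and [p * s = r]: each scaling by [r] divides [phi] by
   exactly [s]. *)
pose e := (1 - alpha)^-1; pose r := s `^ e; pose p := r `^ alpha.
have e0 : 0 < e by rewrite invr_gt0.
have r1 : 1 < r by rewrite -[ltLHS](powR1r e) gt0_ltr_powR ?nnegrE ?ltW.
have r0 : 0 < r by exact: lt_trans r1.
have p1 : 1 < p by rewrite -[ltLHS](powR1r alpha) gt0_ltr_powR ?nnegrE ?ltW.
have p0 : 0 < p by exact: lt_trans p1.
have psr : p * s = r.
  have -> : s = r `^ (1 - alpha) by rewrite -powRrM mulVf ?gt_eqF // powRr1 ?ltW.
  have rN0 : r != 0 by rewrite gt_eqF.
  rewrite /p -powRD ?rN0 ?implybT //.
  by rewrite addrC subrK powRr1 ?ltW.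
have ltpr : p < r by rewrite -psr ltr_pMr.
have [phi [phi_gt0 phi_le phi_scale phi_sum]] :=
  scaling_resolvent_series _ _ p1 ltpr.
have phi_rX k : phi (r ^+ k * a) = s ^- k * phi a.
  elim: k => [|k IHk]; first by rewrite !expr0 invr1 !mul1r.
  rewrite exprS -mulrA phi_scale ?mulr_gt0 ?exprn_gt0 // IHk -psr exprS.
  have := exprn_gt0 k s0 => sk0.
  by field; rewrite ?gt_eqF.
have rXE k : r ^+ k = (s ^+ k) `^ e.
  rewrite -(powR_mulrn k (ltW r0)) -(powR_mulrn k (ltW s0)).
  exact: powRAC.
have xE i : x i = z i `^ e * a.
  by rewrite -powRrM mulfV ?gt_eqF // powRr1 ?divfK ?gt_eqF // divr_ge0 ?ltW.
clearbody p r e z.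
(* With [k] bracketing [z i] between powers of [s], both numbers lie between [s ^- k.+1] and
   [s ^- k], an interval of length at most [s - 1]. *)
have close i : `|phi (x i) / phi a - (z i)^-1| <= s - 1.
  have [k /andP[kz zk]] := exprn_bracket _ _ s1 (z1 i).
  have sk0 : 0 < s ^+ k by exact: exprn_gt0.
  have sk0' : 0 < s ^+ k.+1 by exact: exprn_gt0.
  have zi0 : 0 < z i by exact: lt_le_trans (z1 i).
  have phi_ub : phi (x i) / phi a <= s ^- k.
    rewrite ler_pdivrMr ?phi_gt0 // -phi_rX; apply: phi_le.
      by rewrite mulr_gt0 ?exprn_gt0.
    rewrite xE rXE ler_pM2r //.
    by apply: (ge0_ler_powR (ltW e0)); rewrite // nnegrE ltW.
  have phi_lb : s ^- k.+1 <= phi (x i) / phi a.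
    rewrite ler_pdivlMr ?phi_gt0 // -phi_rX; apply: phi_le; first exact: x0.
    rewrite xE rXE ler_pM2r //.
    by apply: (ge0_ler_powR (ltW e0)); [rewrite nnegrE ltW.. | exact: ltW].
  have z_ub : (z i)^-1 <= s ^- k by rewrite lef_pV2.
  have z_lb : s ^- k.+1 <= (z i)^-1 by rewrite lef_pV2 ?posrE // ltW.
  have gap : s ^- k - s ^- k.+1 <= s - 1.
    have -> : s ^- k - s ^- k.+1 = (s - 1) * s ^- k.+1.
      by rewrite exprS; field; rewrite ?gt_eqF.
    by rewrite ler_piMr ?subr_ge0 ?ltW // invf_lt1 // exprn_egt1.
  by rewrite ler_norml; apply/andP; split; lra.
have phi_a := phi_gt0 a a0.
have sum_phi : \sum_i c i * (phi (x i) / phi a) <= C.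
  under eq_bigr do rewrite mulrA.
  by rewrite -mulr_suml ler_pdivrMr // phi_sum.
apply: le_trans (lerD sum_phi (lexx _)).
rewrite mulr_sumr -big_split /=; apply: ler_sum => i _.
rewrite -lerBlDl -mulrBr (le_trans (ler_norm _)) // normrM mulrC.
by rewrite ler_wpM2r // distrC.
Qed.

(** * Chebyshev polynomials and the bound for a single resolvent *)

(** The factor [h ^+ n] avoids dividing by [h], so that an interval reduced to a point ([h = 0]) is
    covered. The last clause serves to evaluate [P] outside the interval, where it is large. *)
Lemma scaled_chebyshev {R : realFieldType} (m h : R) n : 0 <= h ->
  exists P : {poly R},
  [/\ (size P <= n.+1)%N,
      forall x, `|x - m| <= h -> `|P.[x]| <= h ^+ n
    & forall x d, d ^+ 2 = (x - m) ^+ 2 - h ^+ 2 ->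
        P.[x] = ((x - m + d) ^+ n + (x - m - d) ^+ n) / 2].
Proof.
move=> h0.
(* P and Q are rescaled Chebyshev polynomials of the first and second kind:
   P + i Q sqrt(h^2 - (x-m)^2) = (x - m + i sqrt(h^2 - (x-m)^2))^n. *)
suff [P [Q [sP _ normP PQ]]] : exists P Q : {poly R},
    [/\ (size P <= n.+1)%N, (size Q <= n)%N,
        forall x, P.[x] ^+ 2 + (h ^+ 2 - (x - m) ^+ 2) * Q.[x] ^+ 2 = (h ^+ n) ^+ 2
      & forall x d, d ^+ 2 = (x - m) ^+ 2 - h ^+ 2 ->
        P.[x] + d * Q.[x] = (x - m + d) ^+ n].
  exists P; split=> // [x xm|x d dE].
    rewrite -ler_sqr ?nnegrE ?exprn_ge0 // real_normK ?num_real // -(normP x).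
    rewrite lerDl mulr_ge0 ?sqr_ge0 // subr_ge0 -real_normK ?num_real //.
    by rewrite ler_sqr ?nnegrE.
  (* Averaging the identity over [d] and [- d] cancels the [Q] term. *)
  have dNE : (- d) ^+ 2 = (x - m) ^+ 2 - h ^+ 2 by rewrite sqrrN.
  by rewrite -(PQ x d dE) -(PQ x (- d) dNE); field.
elim: n => [|n [P [Q [sP sQ normP PQ]]]].
  exists 1, 0; split=> [|||x d _]; rewrite ?size_poly1 ?size_poly0 //.
  - by move=> x; rewrite -[1]/(1%:P) hornerC horner0 expr0 expr1n expr0n mulr0 addr0.
  - by rewrite -[1]/(1%:P) hornerC horner0 expr0 mulr0 addr0.
pose L : {poly R} := 'X - m%:P.
(* The two coefficients of [(P + d Q) (L + d)] once [d ^ 2] is replaced by [L ^ 2 - h ^ 2]. *)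
exists (L * P - (h ^+ 2 *: Q - L * (L * Q))), (P + L * Q).
have sL : size L = 2%N by exact: size_XsubC.
have sM (p : {poly R}) k : (size p <= k)%N -> (size (L * p)%R <= k.+1)%N.
  move=> sp; apply: leq_trans (size_polyMleq _ _) _.
  by rewrite sL /= ltnS.
split=> [||x|x d dE].
- apply: leq_trans (size_polyD _ _) _; rewrite size_polyN geq_max sM //=.
  apply: leq_trans (size_polyD _ _) _; rewrite size_polyN geq_max !sM // andbT.
  exact: leq_trans (size_scale_leq _ _) (leqW (leqW sQ)).
- by apply: leq_trans (size_polyD _ _) _; rewrite geq_max sP sM.
- rewrite [h ^+ n.+1]exprS [RHS]exprMn -(normP x) /L.
  by rewrite !(hornerD, hornerN, hornerM, hornerZ, hornerX, hornerC); ring.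
- rewrite [RHS]exprS -(PQ x d dE) /L.
  by rewrite !(hornerD, hornerN, hornerM, hornerZ, hornerX, hornerC); ring: dE.
Qed.

Lemma sum_horner_eq0 {R : comNzRingType} (I : finType) (c x : I -> R) N
    (p : {poly R}) :
  (forall e, (e < N)%N -> \sum_i c i * x i ^+ e = 0) -> (size p <= N)%N ->
  \sum_i c i * p.[x i] = 0.
Proof.
move=> moments sp; under eq_bigr do rewrite (horner_coef_wide _ sp) mulr_sumr.
rewrite exchange_big big1 // => e _ /=.
by under eq_bigr do rewrite mulrCA; rewrite -mulr_sumr moments ?mulr0.
Qed.

(** If [r] takes the value 1 at [- t], then [1 - r] is divisible by ['X + t], so [1 / (x + t)] is a
    polynomial of size at most [N], which the moments annihilate, plus [r(x) / (x + t)]. The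
    normalized Chebyshev polynomial makes this remainder small on [[a, b]]. *)
Lemma resolvent_sum_le {R : rcfType} (I : finType) (c x : I -> R)
    (a b t : R) N :
  0 < a -> 0 < t -> a <= b -> (forall i, a <= x i <= b) ->
  (forall e, (e < N)%N -> \sum_i c i * x i ^+ e = 0) ->
  \sum_i `|c i| <= 1 ->
  \sum_i c i / (x i + t)
    <= 2 * ((Num.sqrt b - Num.sqrt a) / (Num.sqrt b + Num.sqrt a)) ^+ N / (a + t).
Proof.
move=> a0 t0 ab xab moments c1; set q := (_ - _) / _.
have b0 : 0 < b by exact: lt_le_trans ab.
have at0 : 0 < a + t by rewrite addr_gt0.
have bt0 : 0 < b + t by rewrite addr_gt0.
have xt0 i : 0 < x i + t.
  by have /andP[ax _] := xab i; apply: lt_le_trans at0 _; rewrite lerD2r.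
pose A := Num.sqrt (a + t); pose B := Num.sqrt (b + t).
have A0 : 0 < A by rewrite sqrtr_gt0.
have B0 : 0 < B by rewrite sqrtr_gt0.
have AB : A <= B by apply: ler_wsqrtr; rewrite lerD2r.
have A2 : A ^+ 2 = a + t by rewrite sqr_sqrtr ?ltW.
have B2 : B ^+ 2 = b + t by rewrite sqr_sqrtr ?ltW.
pose h := (b - a) / 2; pose m := (a + b) / 2; pose g := (A + B) ^+ 2 / 2.
have h0 : 0 <= h by rewrite divr_ge0 ?subr_ge0.
have g0 : 0 < g by rewrite divr_gt0 ?exprn_gt0 ?addr_gt0.
have [P [sP P_le PE]] := scaled_chebyshev m h N h0.
(* At [x = - t] the square root [d] is [A * B], and the two bases are [- (B - A) ^ 2 / 2] and [- g].
   They are both nonpositive, so their powers share a sign and the smaller one may be dropped. *)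
have Pt : g ^+ N / 2 <= `|P.[- t]|.
  have dE : (A * B) ^+ 2 = (- t - m) ^+ 2 - h ^+ 2.
    by rewrite exprMn A2 B2 /m /h; field.
  rewrite (PE _ _ dE).
  have -> : - t - m + A * B = - ((B - A) ^+ 2 / 2).
    have -> : - t - m = - (A ^+ 2 + B ^+ 2) / 2 by rewrite A2 B2 /m; field.
    by field.
  have -> : - t - m - A * B = - g.
    have -> : - t - m = - (A ^+ 2 + B ^+ 2) / 2 by rewrite A2 B2 /m; field.
    by rewrite /g; field.
  rewrite [(- g) ^+ N]exprNn [(- (_ / 2)) ^+ N]exprNn -mulrDr.
  rewrite !normrM normrX normrN1 expr1n mul1r.
  rewrite normfV [`|2|]ger0_norm // ler_pM2r ?invr_gt0 //.
  by rewrite (le_trans _ (ler_norm _)) // lerDr exprn_ge0 // divr_ge0 ?sqr_ge0.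
have Pt0 : 0 < `|P.[- t]|.
  by apply: lt_le_trans Pt; rewrite divr_gt0 ?exprn_gt0.
have PtN0 : P.[- t] != 0 by rewrite -normr_gt0.
(* [h / g] is the rate belonging to the shifted interval [[a + t, b + t]]; a positive shift lowers
   the ratio of the endpoints and hence the rate. *)
have hgq : h / g <= q.
  have -> : h / g = (B - A) / (B + A).
    have -> : h = (B ^+ 2 - A ^+ 2) / 2 by rewrite A2 B2 /h; field.
    by rewrite /g; field; rewrite gt_eqF // addr_gt0.
  have sa0 : 0 < Num.sqrt a by rewrite sqrtr_gt0.
  have sb0 : 0 < Num.sqrt b by rewrite sqrtr_gt0.
  rewrite /q ler_pdivrMr ?addr_gt0 // mulrAC ler_pdivlMr ?addr_gt0 //.
  rewrite -subr_ge0.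
  have -> : (Num.sqrt b - Num.sqrt a) * (B + A)
              - (B - A) * (Num.sqrt b + Num.sqrt a)
          = 2 * (A * Num.sqrt b - B * Num.sqrt a) by ring.
  rewrite pmulr_rge0 // subr_ge0.
  rewrite -!sqrtrM ?(ltW at0) ?(ltW bt0) //; apply: ler_wsqrtr.
  by rewrite !mulrDl [a * b]mulrC lerD2l ler_pM2l.
have hg0 : 0 <= h / g by rewrite divr_ge0 // ltW.
pose r := P.[- t]^-1 *: P.
have r_le i : `|r.[x i]| <= 2 * q ^+ N.
  have /andP[ax xb] := xab i.
  have xm : `|x i - m| <= h by rewrite ler_norml /h /m; apply/andP; split; lra.
  rewrite hornerZ normrM normfV mulrC ler_pdivrMr //.
  apply: le_trans (P_le _ xm) _.
  apply: (@le_trans _ _ (2 * (h / g) ^+ N * (g ^+ N / 2))).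
    have cancel2 (u w : R) : 2 * u * (w / 2) = u * w by field.
    by rewrite cancel2 -exprMn divfK ?gt_eqF.
  apply: ler_pM => //; rewrite ?mulr_ge0 ?exprn_ge0 ?invr_ge0 ?(ltW g0) //.
  by rewrite ler_pM2l // lerXn2r ?nnegrE // (le_trans hg0).
have root_r : root (1 - r) (- t).
  by rewrite /root hornerD hornerN hornerZ -[1]/(1%:P) hornerC mulVf // subrr.
have /factor_theorem[p pE] := root_r.
have sp : (size p <= N)%N.
  have [->|pN0] := eqVneq p 0; first by rewrite size_poly0.
  have : (size (1 - r)%R <= N.+1)%N.
    apply: leq_trans (size_polyD _ _) _; rewrite size_polyN geq_max size_poly1.
    exact: leq_trans (size_scale_leq _ _) sP.
  by rewrite pE size_Mmonic ?monicXsubC // size_XsubC addn2.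
have decomp i : c i / (x i + t) = c i * p.[x i] + c i * r.[x i] / (x i + t).
  have : (1 - r).[x i] = p.[x i] * (x i + t) by rewrite pE hornerM hornerXsubC opprK.
  rewrite hornerD hornerN -[1]/(1%:P) hornerC => e.
  have -> : p.[x i] = (1 - r.[x i]) / (x i + t) by rewrite e mulfK ?gt_eqF.
  by field; rewrite gt_eqF.
have q0 : 0 <= 2 * q ^+ N by rewrite mulr_ge0 // exprn_ge0 // (le_trans hg0).
under eq_bigr do rewrite decomp.
rewrite big_split /= (sum_horner_eq0 _ _ _ _ _ moments sp) add0r.
apply: (@le_trans _ _ (\sum_i `|c i| * (2 * q ^+ N / (a + t)))); last first.
  by rewrite -mulr_suml ler_piMl // divr_ge0 // ltW.
apply: ler_sum => i _; rewrite (le_trans (ler_norm _)) // -mulrA !normrM.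
rewrite ler_wpM2l //; apply: ler_pM => //.
have /andP[ax _] := xab i.
by rewrite gtr0_norm ?invr_gt0 // lef_pV2 ?posrE // lerD2r.
Qed.

Lemma powR_sum_le {R : realType} (I : finType) (c x : I -> R)
    (a b alpha : R) N :
  0 < alpha < 1 -> 0 < a -> a <= b -> (forall i, a <= x i <= b) ->
  (forall e, (e < N)%N -> \sum_i c i * x i ^+ e = 0) ->
  \sum_i `|c i| <= 1 ->
  \sum_i c i * x i `^ (alpha - 1)
    <= 2 * ((Num.sqrt b - Num.sqrt a) / (Num.sqrt b + Num.sqrt a)) ^+ N
         * a `^ (alpha - 1).
Proof.
move=> al a0 ab xab moments c1; apply: powR_le_resolvents => // [i|t t0].
  by have /andP[] := xab i.
exact: resolvent_sum_le moments c1.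
Qed.

(** * Complex weights and the spectral calculus of a Hermitian matrix *)

Section HermitianPowers.
Local Open Scope complex_scope.
Local Open Scope sesquilinear_scope.

Lemma normr_normc {R : rcfType} (z : R[i]) : `|z| = (normc z)%:C.
Proof. by []. Qed.

Lemma normc_ge0 {R : rcfType} (z : R[i]) : 0 <= normc z.
Proof. by case: z => u v; exact: sqrtr_ge0. Qed.

(** Reduces the modulus of a complex sum to the real part of a rotated one. *)
Lemma rotate_to_real {R : rcfType} (z : R[i]) :
  exists w : R[i], normc w <= 1 /\ complex.Re (w * z) = normc z.
Proof.
have [->|z0] := eqVneq z 0.
  by exists 0; rewrite mul0r !normc0 ler01.
have nz0 : `|z| != 0 by rewrite normr_eq0.
exists (z^* / `|z|); split.
  by rewrite -lecR -normr_normc normrM norm_conjC normfV normr_id mulfV.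
by rewrite mulrAC [_ * z]mulrC -normCK expr2 mulfK.
Qed.

(** After a rotation by [w] the real parts of [w * c i] are real weights to which [powR_sum_le]
    applies: the nodes [x i] are real, so the moments still vanish, and the total mass does not
    exceed 1. *)
Lemma normc_powR_sum_le {R : realType} (I : finType) (c : I -> R[i]) (x : I -> R)
    (a b alpha : R) N :
  0 < alpha < 1 -> 0 < a -> a <= b -> (forall i, a <= x i <= b) ->
  (forall e, (e < N)%N -> \sum_i c i * (x i)%:C ^+ e = 0) ->
  \sum_i normc (c i) <= 1 ->
  normc (\sum_i c i * (x i `^ (alpha - 1))%:C)
    <= 2 * ((Num.sqrt b - Num.sqrt a) / (Num.sqrt b + Num.sqrt a)) ^+ N
         * a `^ (alpha - 1).
Proof.
move=> al a0 ab xab moments c1; set z := \sum_i _.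
have [w [w1 <-]] := rotate_to_real z.
have ReM (u : R[i]) (r : R) : complex.Re (u * r%:C) = complex.Re u * r.
  by case: u => u1 u2 /=; rewrite mulr0 subr0.
have Re_sum (f : I -> R) : complex.Re (w * \sum_i c i * (f i)%:C)
    = \sum_i complex.Re (w * c i) * f i.
  rewrite mulr_sumr raddf_sum; apply: eq_bigr => i _.
  by rewrite mulrA; exact: ReM.
rewrite Re_sum; apply: powR_sum_le => // [e eN|].
  rewrite -Re_sum (_ : \sum_i _ = 0) ?mulr0 // -[RHS](moments e eN).
  by apply: eq_bigr => i _; rewrite rmorphXn.
apply: le_trans c1; apply: ler_sum => i _.
have := normc_ge_Re (w * c i).
rewrite normr_normc lecR normcM => /le_trans; apply.
by rewrite ler_piMl // normc_ge0.
Qed.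

Section SpectralCalculus.
Variables (R : realType) (n : nat) (A : 'M[R[i]]_n).
Local Notation P := (spectralmx A).

(** The argument of [f] is the position of an eigenvalue, so that functions of the real number
    [spectral_val l] fit as well. *)
Definition spectral_fun (f : 'I_n -> R[i]) : 'M[R[i]]_n :=
  P^t* *m diag_mx (\row_l f l) *m P.

Definition spectral_val (l : 'I_n) : R := complex.Re (spectral_diag A 0 l).

Lemma spectral_funE f k j :
  spectral_fun f k j = \sum_l P^t* k l * P l j * f l.
Proof.
rewrite /spectral_fun mul_mx_diag !mxE; apply: eq_bigr => l _.
by rewrite !mxE mulrAC.
Qed.

Lemma spectral_fun1 : spectral_fun (fun=> 1) = 1%:M.
Proof.
rewrite /spectral_fun (_ : \row__ _ = const_mx 1) ?diag_const_mx ?mulmx1.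
  exact/mulmx1C/unitarymxP/spectral_unitarymx.
by apply/rowP => l; rewrite !mxE.
Qed.

Lemma spectral_funM f g :
  spectral_fun (fun l => f l * g l) = spectral_fun f *m spectral_fun g.
Proof.
rewrite /spectral_fun -!mulmxA [P *m (_ *m _)]mulmxA.
rewrite (unitarymxP (spectral_unitarymx A)) mul1mx [diag_mx _ *m (_ *m P)]mulmxA.
rewrite mulmx_diag; congr (_ *m (diag_mx _ *m _)).
by apply/rowP => l; rewrite !mxE.
Qed.

Lemma hermpow_spectral_fun (alpha : R) :
  hermpow A alpha = spectral_fun (fun l => (spectral_val l `^ alpha)%:C).
Proof.
rewrite /hermpow /spectral_fun.
rewrite (_ : map_mx _ _ = \row_l (spectral_val l `^ alpha)%:C) //.
by apply/rowP => l; rewrite !mxE.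
Qed.

(** Columns [k] and [j] of the unitary [P] are unit vectors, and [u w <= (u ^ 2 + w ^ 2) / 2]
    termwise. *)
Lemma spectral_weights_le1 k j : \sum_l normc (P^t* k l * P l j) <= 1.
Proof.
have col_norm k' : \sum_l normc (P l k') ^+ 2 = 1.
  have /matrixP/(_ k' k') := spectral_fun1.
  rewrite spectral_funE mxE eqxx => /(congr1 (@complex.Re R)) /= <-.
  rewrite raddf_sum; apply: eq_bigr => l _.
  rewrite mulr1 !mxE [_ * P l k']mulrC -normCK.
  by rewrite normr_normc -rmorphXn.
have -> : 1 = \sum_l (normc (P l k) ^+ 2 + normc (P l j) ^+ 2) / 2 :> R.
  by rewrite -mulr_suml big_split /= !col_norm; field.
apply: ler_sum => l _; rewrite normcM !mxE.
have -> : normc ((P l k)^*) = normc (P l k).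
  by have := norm_conjC (P l k) => -[].
have := sqr_ge0 (normc (P l k) - normc (P l j)); nra.
Qed.

Hypothesis A_herm : A \is hermsymmx.

(** [eigenvalue] speaks of left eigenvectors; here row [l] of [P] is one. *)
Lemma spectral_eigenvalue l : eigenvalue A (spectral_diag A 0 l).
Proof.
have /orthomx_spectralP AE := hermitian_normalmx A_herm.
apply/eigenvalueP; exists (row l P).
  have PA : P *m A = diag_mx (spectral_diag A) *m P.
    by rewrite [X in _ *m X]AE -mulmxA mulKVmx ?spectral_unit.
  by rewrite -row_mul PA; apply/rowP => j; rewrite mxE mul_diag_mx !mxE.
apply/eqP => /(congr1 (mulmx^~ (P^t*))).
rewrite mul0mx -row_mul (unitarymxP (spectral_unitarymx A)).
by move/rowP/(_ l); rewrite !mxE eqxx => /eqP; rewrite oner_eq0.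
Qed.

Lemma spectral_valE l : (spectral_val l)%:C = spectral_diag A 0 l.
Proof.
by have /mxOverP/(_ 0 l)/RRe_real := hermitian_spectral_diag_real A_herm.
Qed.

Lemma spectral_fun_id : spectral_fun (fun l => (spectral_val l)%:C) = A.
Proof.
have /orthomx_spectralP AE := hermitian_normalmx A_herm.
rewrite [RHS]AE (invmx_unitary (spectral_unitarymx A)).
rewrite /spectral_fun (_ : \row_l _ = spectral_diag A) //.
by apply/rowP => l; rewrite mxE spectral_valE.
Qed.

(** A nonzero entry of [A ^ e] comes from a product of nonzero entries of [A] along a sequence of
    indices. Diagonal factors are not edges, hence a length [m <= e] only. The contrapositive gives
    the vanishing moments. *)
Lemma spectral_funX_walk e k j :
  spectral_fun (fun l => (spectral_val l)%:C ^+ e) k j != 0 ->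
  exists2 m, (m <= e)%N & walk (mxgraph A) m k j.
Proof.
elim: e k => [|e IHe] k.
  have -> : spectral_fun (fun l => (spectral_val l)%:C ^+ 0) = 1%:M := spectral_fun1.
  rewrite mxE; case: (eqVneq k j) => [->|]; last by rewrite eqxx.
  by exists 0%N => //; apply/walkP; exists [::].
have -> : spectral_fun (fun l => (spectral_val l)%:C ^+ e.+1)
        = A *m spectral_fun (fun l => (spectral_val l)%:C ^+ e).
  rewrite -[X in _ = X *m _]spectral_fun_id -spectral_funM.
  by congr spectral_fun; apply/funext => l; rewrite exprS.
set S := spectral_fun _ in IHe *; rewrite mxE => sum_neq0.
have [k' Akk' Sk'] : exists2 k', A k k' != 0 & S k' j != 0.
  case: (pickP (fun k' => A k k' * S k' j != 0)) => [k'|sum0].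
    by rewrite mulf_eq0 negb_or => /andP[? ?]; exists k'.
  by case/eqP: sum_neq0; rewrite big1 // => k' _; apply/eqP/negbFE; exact: sum0.
have [m me /walkP[p [sp kp lp]]] := IHe k' Sk'.
have [ekk'|nkk'] := eqVneq k k'.
  by exists m; [exact: leqW | apply/walkP; exists p; rewrite ekk'].
exists m.+1 => //; apply/walkP; exists (k' :: p).
by rewrite /= sp /mxgraph Akk' nkk'.
Qed.

End SpectralCalculus.

(** * Entries of the power of a positive definite matrix *)

(** The quadratic form at the adjoint of a left eigenvector [v] equals [l] times the squared norm of
    [v]. *)
Lemma hpd_eigenvalue_gt0 {R : realType} n (A : 'M[R[i]]_n) (l : R) :
  hpdmx A -> eigenvalue A l%:C -> 0 < l.
Proof.
move=> [_ A_pos] /eigenvalueP[v vA v0].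
have v0' : v^t* != 0.
  by apply: contra v0 => /eqP vt0; rewrite -[v]trmxCK vt0 trmx0 map_mx0.
have := A_pos _ v0'; rewrite trmxCK vA -scalemxAl mxE.
have vv : 0 <= (v *m v^t*) 0 0.
  rewrite mxE; apply: sumr_ge0 => k _; rewrite !mxE -normCK.
  by rewrite exprn_ge0.
move=> lvv; rewrite -ltcR.
have vv0 : 0 < (v *m v^t*) 0 0.
  rewrite lt_neqAle vv andbT eq_sym; apply/eqP => vvE.
  by rewrite vvE mulr0 ltxx in lvv.
by move: lvv; rewrite pmulr_lgt0.
Qed.

Lemma spectral_val_bounds {R : realType} n (A : 'M[R[i]]_n) (lmin lmax : R) l :
  hpdmx A -> smallest_eigenvalue A lmin -> largest_eigenvalue A lmax ->
  lmin <= spectral_val _ _ A l <= lmax.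
Proof.
move=> [A_herm _] [_ min_le] [_ le_max].
have ev := spectral_eigenvalue _ _ _ A_herm l.
by rewrite -!lecR (spectral_valE _ _ _ A_herm) min_le ?le_max.
Qed.

(** Asking only that [N] lie below every walk length treats finite and infinite distances alike: [N]
    is [d - 1] in the first case and arbitrary in the second. *)
Lemma hermpow_entry_le {R : realType} n (A : 'M[R[i]]_n)
    (lmin lmax alpha : R) (i j : 'I_n) N :
  hpdmx A -> smallest_eigenvalue A lmin -> largest_eigenvalue A lmax ->
  0 < alpha < 1 ->
  (forall m, walk (mxgraph A) m i j -> (N < m)%N) ->
  normc (hermpow A alpha i j)
    <= 2 * lmin `^ (alpha - 1) * rowsum_norm A
       * ((Num.sqrt lmax - Num.sqrt lmin) / (Num.sqrt lmax + Num.sqrt lmin)) ^+ N.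
Proof.
move=> A_hpd smin smax al far; set q := (_ - _) / _.
have [A_herm _] := A_hpd.
have lmin0 := hpd_eigenvalue_gt0 _ _ _ A_hpd smin.1.
have bounds l := spectral_val_bounds _ _ _ _ l A_hpd smin smax.
have lminmax : lmin <= lmax by have /andP[] := bounds i; exact: le_trans.
pose x l := spectral_val _ _ A l.
have x0 l : 0 < x l by have /andP[+ _] := bounds l; exact: lt_le_trans.
pose B := spectral_fun _ _ A (fun l => (x l `^ (alpha - 1))%:C).
have B_le k : A i k != 0 -> normc (B k j) <= 2 * q ^+ N * lmin `^ (alpha - 1).
  move=> Aik; rewrite /B spectral_funE.
  apply: normc_powR_sum_le => // [e eN|]; last exact: spectral_weights_le1.
  (* A nonzero moment of order [e < N] would give a walk from [k] to [j] of length at most [e],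
     hence, after the edge from [i] to [k] if [k] differs from [i], one from [i] to [j] of length at
     most [N]. *)
  apply/eqP; rewrite -spectral_funE; apply/negPn/negP.
  move=> /(spectral_funX_walk _ _ _ A_herm)[m me].
  have [<- wm|nik /walkP[p [sp kp lp]]] := eqVneq i k.
    by have := far m wm; rewrite ltnNge (leq_trans me) // ltnW.
  have /far : walk (mxgraph A) m.+1 i j.
    by apply/walkP; exists (k :: p); rewrite /= sp /mxgraph Aik nik.
  by rewrite ltnS leqNgt (leq_ltn_trans me).
have -> : hermpow A alpha = A *m B.
  rewrite hermpow_spectral_fun -[X in _ = X *m _](spectral_fun_id _ _ _ A_herm).
  rewrite -spectral_funM; congr spectral_fun; apply/funext => l.
  by rewrite -rmorphM mulr_powRB1 ?ltW // ; case/andP: al.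
have q0 : 0 <= q.
  have s0 : 0 < Num.sqrt lmin by rewrite sqrtr_gt0.
  have s1 : Num.sqrt lmin <= Num.sqrt lmax by exact: ler_wsqrtr.
  by rewrite divr_ge0 ?subr_ge0 ?addr_ge0 ?sqrtr_ge0.
have bound0 : 0 <= 2 * q ^+ N * lmin `^ (alpha - 1).
  by rewrite !mulr_ge0 ?exprn_ge0 ?powR_ge0.
have row_le : \sum_k normc (A i k) <= rowsum_norm A.
  exact: (le_bigmax _ (fun i => \sum_k normc (A i k))).
apply: le_trans
  (_ : (\sum_k normc (A i k)) * (2 * q ^+ N * lmin `^ (alpha - 1)) <= _).
  rewrite mxE -lecR -normr_normc (le_trans (ler_norm_sum _ _ _)) // mulr_suml.
  rewrite rmorph_sum; apply: ler_sum => k _ /=.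
  rewrite normr_normc lecR normcM.
  have [->|Aik] := eqVneq (A i k) 0; first by rewrite normc0 !mul0r.
  by rewrite ler_wpM2l ?normc_ge0 // B_le.
apply: le_trans (ler_wpM2r bound0 row_le) _.
by rewrite le_eqVlt; apply/orP; left; apply/eqP; ring.
Qed.

End HermitianPowers.

Theorem theorem3p7 (R : realType) (n : nat) (A : 'M[R[i]]_n)
    (lmin lmax alpha : R) :
  hpdmx A ->
  smallest_eigenvalue A lmin ->
  largest_eigenvalue A lmax ->
  0 < alpha < 1 ->
  let kappa := lmax / lmin in
  let q := (Num.sqrt kappa - 1) / (Num.sqrt kappa + 1) in
  forall i j : 'I_n,
    dist_ge (gdist (mxgraph A) i j) 2 ->
    normc (hermpow A alpha i j)
      <= 2 * lmin `^ (alpha - 1) * rowsum_norm A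
           * decay q (gdist (mxgraph A) i j).
Proof.
move=> A_hpd smin smax al kappa q i j dist2.
have lmin0 := hpd_eigenvalue_gt0 _ _ _ A_hpd smin.1.
have lminmax : lmin <= lmax.
  have /andP[] := spectral_val_bounds _ _ _ _ i A_hpd smin smax.
  exact: le_trans.
have s0 : 0 < Num.sqrt lmin by rewrite sqrtr_gt0.
have s1 : Num.sqrt lmin <= Num.sqrt lmax by exact: ler_wsqrtr.
have qE : q = (Num.sqrt lmax - Num.sqrt lmin) / (Num.sqrt lmax + Num.sqrt lmin).
  have sk : Num.sqrt kappa = Num.sqrt lmax / Num.sqrt lmin.
    by rewrite /kappa sqrtrM ?sqrtrV // ltW // (lt_le_trans lmin0).
  rewrite /q sk; field.
  by rewrite !gt_eqF // ltr_wpDl // (le_trans _ s1) // ltW.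
have entry_le N := hermpow_entry_le _ _ _ _ _ i j N A_hpd smin smax al.
rewrite -qE in entry_le.
case dE: (gdist _ i j) dist2 => [d|] /= dist2.
  have [_ d_min] := (gdist_SomeP _ _ _ _).1 dE.
  apply: entry_le => m /d_min; apply: leq_trans.
  by rewrite subn1 ltn_predL (leq_trans _ dist2).
(* At infinite distance the bound holds for every [N], and [q ^+ N] tends to 0 because [q < 1]; so
   the entry vanishes. *)
rewrite mulr0.
have q0 : 0 <= q by rewrite qE divr_ge0 ?subr_ge0 ?addr_ge0 ?sqrtr_ge0.
have q1 : `|q| < 1.
  have s2 := lt_le_trans s0 s1.
  by rewrite ger0_norm // qE ltr_pdivrMr ?addr_gt0 // mul1r; lra.
have no_walk := (gdist_NoneP _ _ _).1 dE.
set K := 2 * _ * _ in entry_le.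
have cvgK : (K * q ^+ N @[N --> \oo] --> K * 0)%classic.
  by apply: cvgMl_tmp; exact: cvg_expr.
rewrite -(mulr0 K); apply: (cvgr_to_ge cvgK); apply: nearW => N.
by apply: entry_le => m wm; have := no_walk m; rewrite wm.
Qed.
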